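(* Let $p\ge 1$ be an integer and let $z$ be a real number with $0<|z|<1$. Then $$-2\sum_{n=0}^{\infty} \frac{\zeta(2n)z^{2n}}{2n+p} = \sum_{k=0}^{p} \frac{p!\,(-1)^{\lfloor \frac{k+3}{2} \rfloor}}{(p-k)!\,(2\pi z)^k}\,\mathrm{Cl}_{k+1}(2\pi z) + \delta_{\lfloor \frac{p}{2} \rfloor, \frac{p}{2}}\frac{p!\,(-1)^{\frac{p}{2}}}{(2\pi z)^p}\,\zeta(p+1).$$
   Context: The generalized Clausen functions of a real variable $\theta$ are $\mathrm{Cl}_{2j}(\theta)=\sum_{k=1}^\infty \frac{\sin(k\theta)}{k^{2j}}$ for $j\ge1$ and $\mathrm{Cl}_{2j+1}(\theta)=\sum_{k=1}^\infty \frac{\cos(k\theta)}{k^{2j+1}}$ for $j\ge0$; for $\mathrm{Cl}_1$ one takes $\theta\notin 2\pi\mathbb{Z}$, and the series is the conditionally convergent sum. $\zeta$ is the Riemann zeta function, with $\zeta(0)=-\tfrac12$. $\delta_{a,b}$ is the Kronecker delta, so $\delta_{\lfloor n/2\rfloor,n/2}$ is $1$ if $n$ is even and $0$ if $n$ is odd; a term multiplied by it is read as $0$ when $n$ is odd. *)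

(* Defs.v *)
From Stdlib Require Import Reals Factorial.
From Coquelicot Require Import Coquelicot.
Open Scope R_scope.

(* Cl_n(theta) for n >= 1.  Coquelicot series start at index 0, hence the
   shift k = S i.  [Series] is the limit of the partial sums, so for n = 1 and
   theta outside 2 pi Z it is the conditionally convergent sum.  The value at
   n = 0 has no meaning. *)
Definition Cl (n : nat) (theta : R) : R :=
  Series (fun i : nat =>
    (if Nat.even n then sin (INR (S i) * theta) else cos (INR (S i) * theta))
      / INR (S i) ^ n).

(* The Riemann zeta function at the natural numbers s <> 1: the Dirichlet
   series for s >= 2, and the value -1/2 of its analytic continuation at
   s = 0.  At the pole s = 1 the value has no meaning. *)
Definition zeta (s : nat) : R :=
  match s with
  | O => - (1 / 2)
  | _ => Series (fun i : nat => 1 / INR (S i) ^ s)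
  end.

Definition zeta_term (p : nat) (z : R) (n : nat) : R :=
  zeta (2 * n) * z ^ (2 * n) / (2 * INR n + INR p).

(* Main.v *)
Require Import Defs.
From Stdlib Require Import Reals Factorial Lra Lia.
From Coquelicot Require Import Coquelicot.
Open Scope R_scope.

(** Multiplied by z^p, both sides are the integral of pi x^p cot(pi x) over
    [0, z], computed in two ways.

    - Since pi x cot(pi x) = -2 sum_n zeta(2n) x^(2n), integrating the power
      series gives the left-hand side.
    - In the sense of distributions cot(pi x) = 2 sum_k sin(2 pi k x).
      Integrating x^p sin(2 pi k x) by parts repeatedly and summing over k
      gives the Clausen values; for even p the boundary term at 0 survives and
      sums to the multiple of zeta(p + 1).

    Neither the singular integrand nor the values of Cl_1 have to be handled.
    Both expansions are cut off at the same rank n, and the integral of the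
    difference of the two partial sums tends to 0
    ([zeta_sine_integral_vanishes]): by the closed form of the Dirichlet
    kernel, this difference is
    pi x^p cos((2n + 3) pi x) / sin(pi x) up to a uniformly small error, and
    the factor in front of the cosine stays bounded at 0, so the
    Riemann-Lebesgue argument of [RInt_oscillating_vanishes] applies.  All
    the series involved except the one of Cl_1 converge absolutely, so
    the conditional convergence of the latter, with the right value, comes
    out of the limit.

    The expansion of the cotangent is obtained from the same
    Riemann-Lebesgue lemma: the Fourier series of x |-> cos(t (pi - x)) at
    x = 0 is the partial fraction expansion of pi t cot(pi t)
    ([cot_partial_fractions]), and summing geometric series turns it into the
    zeta expansion with an explicit remainder ([cot_remainder_series]).

    The computation is done for z > 0; both sides are even in z. *)

(** * Integrals of oscillating functions *)

Lemma ex_RInt_continuous_on (f : R -> R) (a b : R) :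
  a <= b -> (forall x, a <= x <= b -> continuous f x) -> ex_RInt f a b.
Proof.
  intros hab hf. apply (ex_RInt_continuous (V := R_CompleteNormedModule)).
  rewrite Rmin_left, Rmax_right by lra. exact hf.
Qed.

Lemma abs_RInt_le_open (f : R -> R) (a b M : R) :
  a <= b -> ex_RInt f a b -> (forall x, a < x < b -> Rabs (f x) <= M) ->
  Rabs (RInt f a b) <= M * (b - a).
Proof.
  intros hab hf hM.
  assert (hc : forall c, ex_RInt (V := R_NormedModule) (fun _ : R => c) a b)
    by (intros c; apply ex_RInt_const).
  assert (hi : forall c : R, RInt (fun _ : R => c) a b = (b - a) * c)
    by (intros c; exact (RInt_const a b c)).
  assert (h1 : RInt f a b <= RInt (fun _ => M) a b).
  { apply RInt_le; auto. intros x hx. specialize (hM x hx).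
    apply Rabs_le_between in hM. lra. }
  assert (h2 : RInt (fun _ => - M) a b <= RInt f a b).
  { apply RInt_le; auto. intros x hx. specialize (hM x hx).
    apply Rabs_le_between in hM. lra. }
  rewrite hi in h1, h2. apply Rabs_le. lra.
Qed.

(** One integration by parts moves the derivative to [h] and gains a factor
    1 / l; the constant K does not depend on the frequency. *)
Lemma RInt_C1_sin_bound (h dh : R -> R) (a b c : R) :
  a <= b ->
  (forall x, a <= x <= b -> is_derive h x (dh x)) ->
  (forall x, a <= x <= b -> continuous dh x) ->
  exists K, forall l, 0 < l ->
    ex_RInt (fun x => h x * sin (l * x + c)) a b /\
    Rabs (RInt (fun x => h x * sin (l * x + c)) a b) <= K / l.
Proof.
  intros hab hd hc.
  assert (hci : ex_RInt dh a b).
  { apply ex_RInt_continuous_on; [exact hab |]. exact hc. }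
  exists (Rabs (h a) + Rabs (h b) + RInt (fun x => Rabs (dh x)) a b).
  intros l hl.
  assert (htrig : forall x : R, continuous (fun x => cos (l * x + c)) x).
  { intros x. apply (ex_derive_continuous (fun x => cos (l * x + c))).
    auto_derive. exact I. }
  assert (hex : ex_RInt (fun x => h x * sin (l * x + c)) a b).
  { apply ex_RInt_continuous_on; [exact hab |].
    intros x hx. apply (continuous_mult h (fun x => sin (l * x + c))).
    - apply (ex_derive_continuous h). exists (dh x). now apply hd.
    - apply (ex_derive_continuous (fun x => sin (l * x + c))). auto_derive. exact I. }
  assert (hex2 : ex_RInt (fun x => dh x * cos (l * x + c)) a b).
  { apply ex_RInt_continuous_on; [exact hab |].
    intros x hx. apply (continuous_mult dh (fun x => cos (l * x + c))); auto. }
  split; [exact hex |].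
  assert (hF : is_RInt (fun x => l * (h x * sin (l * x + c)) - dh x * cos (l * x + c)) a b
     (- h b * cos (l * b + c) - - h a * cos (l * a + c))).
  { apply (is_RInt_derive (fun x => - h x * cos (l * x + c))).
    - rewrite Rmin_left, Rmax_right by lra. intros x hx.
      specialize (hd x hx). auto_derive.
      + now exists (dh x).
      + replace (Derive (fun x => h x) x) with (dh x)
          by (symmetry; apply is_derive_unique, hd). ring.
    - rewrite Rmin_left, Rmax_right by lra. intros x hx.
      apply (continuous_minus (fun x => l * (h x * sin (l * x + c)))
               (fun x => dh x * cos (l * x + c))).
      + apply (continuous_mult (fun _ => l) (fun x => h x * sin (l * x + c))).
        * apply continuous_const.
        * apply (continuous_mult h (fun x => sin (l * x + c))).
          -- apply (ex_derive_continuous h). exists (dh x). now apply hd.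
          -- apply (ex_derive_continuous (fun x => sin (l * x + c))).
             auto_derive. exact I.
      + apply (continuous_mult dh (fun x => cos (l * x + c))); auto. }
  assert (hI : is_RInt (fun x => l * (h x * sin (l * x + c)) - dh x * cos (l * x + c)) a b
     (l * RInt (fun x => h x * sin (l * x + c)) a b
      - RInt (fun x => dh x * cos (l * x + c)) a b)).
  { apply (is_RInt_minus (V := R_NormedModule)
             (fun x => l * (h x * sin (l * x + c)))
             (fun x => dh x * cos (l * x + c))).
    - apply (is_RInt_scal (V := R_NormedModule) (fun x => h x * sin (l * x + c))).
      now apply (RInt_correct (V := R_CompleteNormedModule)).
    - now apply (RInt_correct (V := R_CompleteNormedModule)). }
  assert (heq := is_RInt_unique _ _ _ _ hF).
  rewrite (is_RInt_unique _ _ _ _ hI) in heq.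
  assert (hcos : forall u v, Rabs (u * cos v) <= Rabs u).
  { intros u v. rewrite Rabs_mult. rewrite <- (Rmult_1_r (Rabs u)) at 2.
    apply Rmult_le_compat_l; [apply Rabs_pos |]. apply Rabs_le, COS_bound. }
  assert (hb2 : Rabs (RInt (fun x => dh x * cos (l * x + c)) a b)
                <= RInt (fun x => Rabs (dh x)) a b).
  { apply Rle_trans with (RInt (fun x => Rabs (dh x * cos (l * x + c))) a b).
    - apply (abs_RInt_le (fun x => dh x * cos (l * x + c))); auto.
    - apply RInt_le; auto.
      + apply (ex_RInt_norm (fun x => dh x * cos (l * x + c))). exact hex2.
      + apply (ex_RInt_norm dh). exact hci. }
  apply (Rmult_le_reg_l l); [exact hl |].
  rewrite <- (Rabs_pos_eq l) at 1 by lra. rewrite <- Rabs_mult.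
  replace (l * ((Rabs (h a) + Rabs (h b) + RInt (fun x => Rabs (dh x)) a b) / l))
    with (Rabs (h a) + Rabs (h b) + RInt (fun x => Rabs (dh x)) a b) by (field; lra).
  generalize (hcos (h a) (l * a + c)) (hcos (h b) (l * b + c)).
  apply Rabs_le_between in hb2. intros h1 h2.
  apply Rabs_le_between in h1. apply Rabs_le_between in h2.
  apply Rabs_le. lra.
Qed.

(** A form of the Riemann-Lebesgue lemma in which the amplitude [h] may be
    singular (though bounded) at 0.  The integrands [H n] are continuous up to
    0 and equal h(x) sin(l_n x + c) only up to [e n], so that one never
    integrates [h] across 0: a short interval [0, dl] contributes at most
    (M + 1) dl, and on [dl, a] integration by parts applies. *)
Lemma RInt_oscillating_vanishes (H : nat -> R -> R) (h dh : R -> R)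
    (l e : nat -> R) (a c d M : R) :
  0 < d <= a ->
  (forall n x, continuous (H n) x) ->
  (forall x, 0 < x <= a -> is_derive h x (dh x)) ->
  (forall x, 0 < x <= a -> continuous dh x) ->
  (forall x, 0 < x <= d -> Rabs (h x) <= M) ->
  (forall n x, 0 < x < a -> Rabs (H n x - h x * sin (l n * x + c)) <= e n) ->
  is_lim_seq l p_infty -> is_lim_seq e 0 ->
  is_lim_seq (fun n => RInt (H n) 0 a) 0.
Proof.
  intros hd hH hh hdh hM hosc hl he.
  assert (hM0 : 0 <= M).
  { apply Rle_trans with (Rabs (h d)); [apply Rabs_pos | apply hM; lra]. }
  assert (hexH : forall n u v, ex_RInt (H n) u v).
  { intros n u v. apply (ex_RInt_continuous (V := R_CompleteNormedModule)). intros x _. apply hH. }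
  apply is_lim_seq_spec. intros eps.
  (* [0, dl], the error [e n] and the oscillation each cost at most eps / 3. *)
  set (dl := Rmin d (eps / (3 * (M + 1)))).
  assert (hdl : 0 < dl /\ dl <= d /\ dl * (M + 1) <= eps / 3).
  { assert (h0 : 0 < eps / (3 * (M + 1))).
    { apply Rdiv_lt_0_compat; [apply cond_pos | lra]. }
    unfold dl. split; [apply Rmin_pos; lra |]. split; [apply Rmin_l |].
    apply Rle_trans with (eps / (3 * (M + 1)) * (M + 1)).
    - apply Rmult_le_compat_r; [lra | apply Rmin_r].
    - apply Req_le. field. lra. }
  destruct hdl as [hdl0 [hdld hdle]].
  destruct (RInt_C1_sin_bound h dh dl a c) as [K hK].
  { lra. } { intros; apply hh; lra. } { intros; apply hdh; lra. }
  apply is_lim_seq_spec in he. apply is_lim_seq_spec in hl.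
  assert (heps := cond_pos eps).
  assert (hr : 0 < Rmin 1 (eps / (3 * (a + 1)))).
  { apply Rmin_pos; [lra |]. apply Rdiv_lt_0_compat; lra. }
  destruct (he (mkposreal _ hr)) as [N1 hN1]. simpl in hN1.
  destruct (hl (Rmax 1 (3 * Rabs K / eps + 1))) as [N2 hN2].
  exists (max N1 N2). intros n hn.
  specialize (hN1 n ltac:(lia)). specialize (hN2 n ltac:(lia)).
  rewrite Rminus_0_r in *.
  assert (he1 : e n <= 1 /\ e n * (a + 1) <= eps / 3).
  { apply Rabs_lt_between in hN1. split.
    - apply Rle_trans with (1 := Rlt_le _ _ (proj2 hN1)). apply Rmin_l.
    - apply Rle_trans with (eps / (3 * (a + 1)) * (a + 1)).
      + apply Rmult_le_compat_r; [lra |].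
        apply Rle_trans with (1 := Rlt_le _ _ (proj2 hN1)). apply Rmin_r.
      + apply Req_le. field. lra. }
  destruct he1 as [he1 he2].
  assert (hl0 : 1 < l n) by (apply Rle_lt_trans with (2 := hN2); apply Rmax_l).
  assert (hlK : 3 * Rabs K / eps + 1 < l n)
    by (apply Rle_lt_trans with (2 := hN2); apply Rmax_r).
  assert (he0 : 0 <= e n).
  { apply Rle_trans with (2 := hosc n (d / 2) ltac:(lra)). apply Rabs_pos. }
  rewrite <- (RInt_Chasles (H n) 0 dl a) by apply hexH.
  change (Rabs (RInt (H n) 0 dl + RInt (H n) dl a) < eps).
  assert (hA : Rabs (RInt (H n) 0 dl) <= (M + 1) * (dl - 0)).
  { apply abs_RInt_le_open; [lra | apply hexH |]. intros x hx.
    assert (h1 := hosc n x ltac:(lra)). assert (h2 := hM x ltac:(lra)).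
    assert (h3 : Rabs (h x * sin (l n * x + c)) <= M).
    { rewrite Rabs_mult. rewrite <- (Rmult_1_r M).
      apply Rmult_le_compat; try apply Rabs_pos; auto.
      apply Rabs_le, SIN_bound. }
    apply Rabs_le_between in h1. apply Rabs_le_between in h3.
    apply Rabs_le. lra. }
  destruct (hK (l n) ltac:(lra)) as [hex hKn].
  assert (hB : Rabs (RInt (fun x => H n x - h x * sin (l n * x + c)) dl a)
               <= e n * (a - dl)).
  { apply abs_RInt_le_open; [lra | |].
    - apply (ex_RInt_minus (H n) (fun x => h x * sin (l n * x + c))); auto.
    - intros x hx. apply hosc. lra. }
  assert (hBe : RInt (fun x => H n x - h x * sin (l n * x + c)) dl a
     = RInt (H n) dl a - RInt (fun x => h x * sin (l n * x + c)) dl a).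
  { apply (RInt_minus (H n) (fun x => h x * sin (l n * x + c))); auto. }
  rewrite hBe in hB.
  assert (hC : K / l n < eps / 3).
  { apply (Rmult_lt_reg_r (l n)); [lra |].
    replace (K / l n * l n) with K by (field; lra).
    apply Rle_lt_trans with (Rabs K); [apply Rle_abs |].
    apply Rlt_le_trans with (eps / 3 * (3 * Rabs K / eps + 1)).
    - replace (eps / 3 * (3 * Rabs K / eps + 1)) with (Rabs K + eps / 3)
        by (field; lra). lra.
    - apply Rmult_le_compat_l; lra. }
  assert (hD : e n * (a - dl) <= eps / 3) by nra.
  assert (hE : (M + 1) * (dl - 0) <= eps / 3) by lra.
  apply Rabs_le_between in hA. apply Rabs_le_between in hB.
  apply Rabs_le_between in hKn. apply Rabs_def1; lra.
Qed.

(** * Finite sums and Dirichlet kernels *)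

Lemma is_series_sum_f_R0 (a : nat -> R) (l : R) :
  is_series a l <-> is_lim_seq (sum_f_R0 a) l.
Proof.
  split; intros h.
  - apply (is_lim_seq_ext (sum_n a)); [intros n; apply sum_n_Reals | exact h].
  - apply (is_lim_seq_ext (sum_f_R0 a) (sum_n a) l); [| exact h].
    intros n; symmetry; apply sum_n_Reals.
Qed.

Lemma continuous_sum_f_R0 (f : nat -> R -> R) (n : nat) (x : R) :
  (forall k, continuous (f k) x) ->
  continuous (fun y => sum_f_R0 (fun k => f k y) n) x.
Proof.
  intros hf. induction n as [| n IH]; [exact (hf 0%nat) |].
  apply (continuous_plus (fun y => sum_f_R0 (fun k => f k y) n) (f (S n))); auto.
Qed.

Lemma is_RInt_sum_f_R0 (f : nat -> R -> R) (I : nat -> R) (a b : R) (n : nat) :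
  (forall k, is_RInt (f k) a b (I k)) ->
  is_RInt (fun x => sum_f_R0 (fun k => f k x) n) a b (sum_f_R0 I n).
Proof.
  intros hf. induction n as [| n IH]; [exact (hf 0%nat) |].
  apply (is_RInt_plus (fun x => sum_f_R0 (fun k => f k x) n) (f (S n))); auto.
Qed.

Lemma is_RInt_antiderivative (F f : R -> R) (a b : R) :
  (forall x, is_derive F x (f x)) -> (forall x, continuous f x) ->
  is_RInt f a b (F b - F a).
Proof.
  intros hF hf. apply (is_RInt_derive F f); intros; auto.
Qed.

Lemma dirichlet_kernel_cos (n : nat) (t : R) :
  2 * sin (t / 2) * (1 / 2 + sum_f_R0 (fun k => cos (INR (S k) * t)) n)
  = sin ((INR n + 3 / 2) * t).
Proof.
  assert (step : forall a, 2 * sin (t / 2) * cos a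
                           = sin (a + t / 2) - sin (a - t / 2)).
  { intros a. rewrite sin_plus, sin_minus. ring. }
  induction n as [| n IH].
  - cbn [sum_f_R0]. rewrite Rmult_plus_distr_l, step. simpl INR.
    replace (1 * t - t / 2) with (t / 2) by field.
    replace ((0 + 3 / 2) * t) with (1 * t + t / 2) by field. field.
  - cbn [sum_f_R0]. rewrite <- Rplus_assoc, Rmult_plus_distr_l, IH, step.
    rewrite !S_INR.
    replace ((INR n + 1 + 1) * t - t / 2) with ((INR n + 3 / 2) * t) by field.
    replace ((INR n + 1 + 3 / 2) * t) with ((INR n + 1 + 1) * t + t / 2) by field.
    ring.
Qed.

Lemma dirichlet_kernel_sin (n : nat) (t : R) :
  2 * sin (t / 2) * sum_f_R0 (fun k => sin (INR (S k) * t)) n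
  = cos (t / 2) - cos ((INR n + 3 / 2) * t).
Proof.
  assert (step : forall a, 2 * sin (t / 2) * sin a
                           = cos (a - t / 2) - cos (a + t / 2)).
  { intros a. rewrite cos_plus, cos_minus. ring. }
  induction n as [| n IH].
  - cbn [sum_f_R0]. rewrite step. simpl INR. f_equal; f_equal; field.
  - cbn [sum_f_R0]. rewrite Rmult_plus_distr_l, IH, step, !S_INR.
    replace ((INR n + 1 + 1) * t - t / 2) with ((INR n + 3 / 2) * t) by field.
    replace ((INR n + 1 + 3 / 2) * t) with ((INR n + 1 + 1) * t + t / 2) by field.
    ring.
Qed.

Lemma sin_ge_half (x : R) : 0 <= x <= 1 -> x / 2 <= sin x.
Proof.
  intros hx.
  destruct (MVT_gen sin 0 x cos) as [c [hc heq]].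
  - intros y _. apply is_derive_sin.
  - intros y _. apply continuity_sin.
  - rewrite Rmin_left, Rmax_right in hc by lra. rewrite sin_0 in heq.
    assert (hpi := PI2_3_2).
    assert (h : cos (PI / 3) <= cos c) by (apply cos_decr_1; lra).
    rewrite cos_PI3 in h. nra.
Qed.

Lemma cos_lipschitz (u v : R) : Rabs (cos u - cos v) <= Rabs (u - v).
Proof.
  destruct (MVT_gen cos v u (fun y => - sin y)) as [c [_ heq]].
  - intros y _. apply is_derive_cos.
  - intros y _. apply continuity_cos.
  - rewrite heq, Rabs_mult, Rabs_Ropp. rewrite <- (Rmult_1_l (Rabs (u - v))) at 2.
    apply Rmult_le_compat_r; [apply Rabs_pos | apply Rabs_le, SIN_bound].
Qed.

Lemma sin_INR_PI (k : nat) : sin (INR k * PI) = 0.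
Proof. apply sin_eq_0_1. exists (Z.of_nat k). now rewrite INR_IZR_INZ. Qed.

Lemma is_lim_seq_frequency (w : R) :
  0 < w -> is_lim_seq (fun n => w * (INR n + 3 / 2)) p_infty.
Proof.
  intros hw.
  apply (is_lim_seq_le_p_loc (fun n => w * INR n)).
  - exists 0%nat. intros n _. apply Rmult_le_compat_l; lra.
  - replace p_infty with (Rbar_mult w p_infty)
      by (apply is_Rbar_mult_unique, is_Rbar_mult_sym, is_Rbar_mult_p_infty_pos;
          exact hw).
    apply is_lim_seq_scal_l, is_lim_seq_INR.
Qed.

(** * Expansions of the cotangent *)

Lemma RInt_cos_dirichlet (t : R) (n : nat) :
  0 < t < 1 ->
  is_RInt (fun x => (cos (t * (PI - x)) - cos (t * PI))
             * (1 / 2 + sum_f_R0 (fun k => cos (INR (S k) * x)) n)) 0 PI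
    (sin (PI * t) / (2 * t)
       * (1 + sum_f_R0 (fun k => 2 * t ^ 2 / (t ^ 2 - INR (S k) ^ 2)) n)
     - PI / 2 * cos (PI * t)).
Proof.
  intros ht.
  set (f := fun k x => (cos (t * (PI - x)) - cos (t * PI)) * cos (INR (S k) * x)).
  apply (is_RInt_ext (fun x => (cos (t * (PI - x)) - cos (t * PI)) / 2
                               + sum_f_R0 (fun k => f k x) n)).
  { intros x _. unfold f. rewrite Rmult_plus_distr_l. f_equal; [field |].
    rewrite scal_sum. apply sum_eq. intros; ring. }
  replace (sin (PI * t) / (2 * t)
       * (1 + sum_f_R0 (fun k => 2 * t ^ 2 / (t ^ 2 - INR (S k) ^ 2)) n)
     - PI / 2 * cos (PI * t)) with
    ((sin (PI * t) / (2 * t) - PI / 2 * cos (PI * t)) +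
     sum_f_R0 (fun k => sin (PI * t) * t / (t ^ 2 - INR (S k) ^ 2)) n).
  2:{ rewrite (sum_eq _ (fun k => 2 * t ^ 2 / (t ^ 2 - INR (S k) ^ 2)
                                  * (sin (PI * t) / (2 * t)))).
      - rewrite <- scal_sum. field. lra.
      - intros k _. rewrite S_INR. assert (h := pos_INR k).
        assert (hne : t ^ 2 - (INR k + 1) ^ 2 < 0) by nra.
        field. split; lra. }
  apply (is_RInt_plus (fun x => (cos (t * (PI - x)) - cos (t * PI)) / 2)
           (fun x => sum_f_R0 (fun k => f k x) n)).
  - replace (sin (PI * t) / (2 * t) - PI / 2 * cos (PI * t)) with
      ((- sin (t * (PI - PI)) / (2 * t) - PI * cos (t * PI) / 2)
       - (- sin (t * (PI - 0)) / (2 * t) - 0 * cos (t * PI) / 2)).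
    2:{ rewrite Rminus_diag, Rmult_0_r, sin_0, Rminus_0_r, (Rmult_comm t PI).
        field. lra. }
    apply (is_RInt_antiderivative
             (fun x => - sin (t * (PI - x)) / (2 * t) - x * cos (t * PI) / 2)).
    + intros x. auto_derive; [exact I |]. unfold Rminus. field. lra.
    + intros x. apply (ex_derive_continuous
        (fun x => (cos (t * (PI - x)) - cos (t * PI)) / 2)). now auto_derive.
  - apply is_RInt_sum_f_R0. intros k. unfold f.
    assert (hk : 1 <= INR (S k)).
    { rewrite S_INR. assert (h := pos_INR k). lra. }
    assert (hs : sin (INR (S k) * PI) = 0) by apply sin_INR_PI.
    set (m := INR (S k)) in *.
    assert (hne : t ^ 2 - m ^ 2 < 0) by nra.
    assert (hne' : m ^ 2 - t ^ 2 > 0) by lra.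
    set (F := fun x => (t * sin (t * (PI - x)) * cos (m * x)
                        + m * cos (t * (PI - x)) * sin (m * x)) / (m ^ 2 - t ^ 2)
                       - cos (t * PI) * sin (m * x) / m).
    replace (sin (PI * t) * t / (t ^ 2 - m ^ 2)) with (F PI - F 0).
    2:{ unfold F. rewrite Rminus_diag, !Rmult_0_r, Rminus_0_r, sin_0, cos_0, hs.
        rewrite (Rmult_comm t PI). field. lra. }
    apply is_RInt_antiderivative.
    + intros x. unfold F. auto_derive; [exact I |].
      unfold Rminus in *. field. split; lra.
    + intros x. apply (ex_derive_continuous
        (fun x => (cos (t * (PI - x)) - cos (t * PI)) * cos (m * x))).
      now auto_derive.
Qed.

(** The function g(x) = cos(t (pi - x)) - cos(t pi) vanishes at 0, hence its
    quotient by 2 sin(x / 2) is bounded and its integrals against the Dirichlet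
    kernel tend to 0.  These integrals are, up to a factor, the differences
    between the partial sums and the claimed sum. *)
Lemma cot_partial_fractions (t : R) :
  0 < t < 1 ->
  is_series (fun k => 2 * t ^ 2 / (t ^ 2 - INR (S k) ^ 2))
    (PI * t * cos (PI * t) / sin (PI * t) - 1).
Proof.
  intros ht. assert (hpi := PI2_3_2).
  assert (hsin : 0 < sin (PI * t)) by (apply sin_gt_0; nra).
  assert (hs : forall x, 0 < x <= PI -> 0 < sin (x / 2))
    by (intros; apply sin_gt_0; lra).
  set (H := fun n x => (cos (t * (PI - x)) - cos (t * PI))
             * (1 / 2 + sum_f_R0 (fun k => cos (INR (S k) * x)) n)).
  set (dh := fun x =>
     (t * sin (t * (PI - x)) * sin (x / 2)
      - (cos (t * (PI - x)) - cos (t * PI)) * cos (x / 2) / 2)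
     / (2 * sin (x / 2) ^ 2)).
  assert (hlim : is_lim_seq (fun n => RInt (H n) 0 PI) 0).
  { apply (RInt_oscillating_vanishes H
      (fun x => (cos (t * (PI - x)) - cos (t * PI)) / (2 * sin (x / 2)))
      dh (fun n => 1 * (INR n + 3 / 2)) (fun _ => 0) PI 0 2 2).
    - lra.
    - intros n x. unfold H.
      apply (continuous_mult (fun x => cos (t * (PI - x)) - cos (t * PI))
        (fun x => 1 / 2 + sum_f_R0 (fun k => cos (INR (S k) * x)) n)).
      + apply (ex_derive_continuous (fun x => cos (t * (PI - x)) - cos (t * PI))).
        now auto_derive.
      + apply (continuous_plus (fun _ => 1 / 2)
          (fun x => sum_f_R0 (fun k => cos (INR (S k) * x)) n)).
        * apply continuous_const.
        * apply (continuous_sum_f_R0 (fun k x => cos (INR (S k) * x))).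
          intros k. apply (ex_derive_continuous (fun x => cos (INR (S k) * x))).
          auto_derive. exact I.
    - intros x hx. specialize (hs x hx). unfold dh. auto_derive.
      + lra.
      + unfold Rminus, Rdiv in *. field. lra.
    - intros x hx. specialize (hs x hx). apply (ex_derive_continuous dh).
      unfold dh. auto_derive. nra.
    - intros x hx. specialize (hs x ltac:(lra)).
      assert (h1 := sin_ge_half (x / 2) ltac:(lra)).
      assert (h2 := cos_lipschitz (t * (PI - x)) (t * PI)).
      replace (t * (PI - x) - t * PI) with (- (t * x)) in h2 by ring.
      rewrite Rabs_Ropp, (Rabs_pos_eq (t * x)) in h2 by nra.
      rewrite Rabs_div by lra. rewrite (Rabs_pos_eq (2 * sin (x / 2))) by lra.
      apply Rcomplements.Rle_div_l; nra.
    - intros n x hx. specialize (hs x ltac:(lra)). unfold H.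
      rewrite Rplus_0_r, Rmult_1_l, <- dirichlet_kernel_cos.
      apply Req_le. transitivity (Rabs 0); [f_equal; field; lra | apply Rabs_R0].
    - apply is_lim_seq_frequency. lra.
    - apply is_lim_seq_const. }
  apply is_series_sum_f_R0.
  apply (is_lim_seq_ext
    (fun n => RInt (H n) 0 PI * (2 * t / sin (PI * t))
              + (PI * t * cos (PI * t) / sin (PI * t) - 1))).
  - intros n. unfold H.
    rewrite (is_RInt_unique _ _ _ _ (RInt_cos_dirichlet t n ht)). field. lra.
  - replace (Finite (PI * t * cos (PI * t) / sin (PI * t) - 1)) with
      (Finite (0 * (2 * t / sin (PI * t))
               + (PI * t * cos (PI * t) / sin (PI * t) - 1)))
      by (f_equal; ring).
    apply is_lim_seq_plus'; [| apply is_lim_seq_const].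
    apply is_lim_seq_mult'; [exact hlim | apply is_lim_seq_const].
Qed.

Lemma is_series_eq (a b : nat -> R) (l : R) :
  (forall n, a n = b n) -> is_series a l -> is_series b l.
Proof. exact (is_series_ext (V := R_NormedModule) a b l). Qed.

(** * Zeta values and the remainder of the cotangent series *)

Lemma INR_S_ge_1 (k : nat) : 1 <= INR (S k).
Proof. rewrite S_INR. assert (h := pos_INR k). lra. Qed.

Lemma inv_pow_le_inv_square (k s : nat) :
  (2 <= s)%nat -> 0 <= 1 / INR (S k) ^ s <= 1 / INR (S k) ^ 2.
Proof.
  intros hs. assert (hk := INR_S_ge_1 k).
  assert (h2 : 0 < INR (S k) ^ 2) by (apply pow_lt; lra).
  assert (h : INR (S k) ^ 2 <= INR (S k) ^ s) by (now apply Rle_pow).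
  unfold Rdiv. rewrite !Rmult_1_l. split.
  - apply Rlt_le, Rinv_0_lt_compat. lra.
  - now apply Rinv_le_contravar.
Qed.

(** At t = 1/2 the partial fraction series of the cotangent is, up to a
    constant, the series of 1 / (k^2 - 1/4), which dominates 1 / k^2. *)
Lemma ex_series_inv_square : ex_series (fun k => 1 / INR (S k) ^ 2).
Proof.
  apply (ex_series_le (V := R_CompleteNormedModule) _
    (fun k => -2 * (2 * (1 / 2) ^ 2 / ((1 / 2) ^ 2 - INR (S k) ^ 2)))).
  - intros k. change norm with Rabs. assert (hk := INR_S_ge_1 k).
    set (m := INR (S k)) in *.
    assert (hm : 0 < m ^ 2 - 1 / 4) by nra.
    rewrite Rabs_pos_eq by (apply Rlt_le, Rdiv_lt_0_compat; nra).
    replace (-2 * (2 * (1 / 2) ^ 2 / ((1 / 2) ^ 2 - m ^ 2)))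
      with (/ (m ^ 2 - 1 / 4)) by (field; split; nra).
    unfold Rdiv at 1. rewrite Rmult_1_l. apply Rinv_le_contravar; lra.
  - apply (ex_series_scal (-2)
      (fun k => 2 * (1 / 2) ^ 2 / ((1 / 2) ^ 2 - INR (S k) ^ 2))).
    eexists. apply (cot_partial_fractions (1 / 2)). lra.
Qed.

Lemma ex_series_inv_pow (s : nat) :
  (2 <= s)%nat -> ex_series (fun k => 1 / INR (S k) ^ s).
Proof.
  intros hs.
  apply (ex_series_le (V := R_CompleteNormedModule) _ (fun k => 1 / INR (S k) ^ 2)).
  - intros k. change norm with Rabs. destruct (inv_pow_le_inv_square k s hs).
    now rewrite Rabs_pos_eq.
  - apply ex_series_inv_square.
Qed.

Lemma is_series_zeta (s : nat) :
  (2 <= s)%nat -> is_series (fun k => 1 / INR (S k) ^ s) (zeta s).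
Proof.
  intros hs. destruct s as [| s]; [lia |].
  apply Series_correct. now apply ex_series_inv_pow.
Qed.

Lemma zeta_le_zeta_2 (s : nat) : (2 <= s)%nat -> 0 <= zeta s <= zeta 2.
Proof.
  intros hs.
  assert (h : forall r, (2 <= r)%nat -> zeta r = Series (fun k => 1 / INR (S k) ^ r)).
  { intros [| r] hr; [lia | reflexivity]. }
  rewrite !h by lia. split.
  - replace 0 with (Series (fun k => 0 * (1 / INR (S k) ^ s)))
      by (rewrite Series_scal_l; ring).
    apply Series_le; [| now apply ex_series_inv_pow].
    intros k. destruct (inv_pow_le_inv_square k s hs). lra.
  - apply Series_le; [| apply ex_series_inv_square].
    intros k. now apply inv_pow_le_inv_square.
Qed.

Lemma ex_series_zeta_term (p : nat) (z : R) :
  (1 <= p)%nat -> Rabs z < 1 -> ex_series (zeta_term p z).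
Proof.
  intros hp hz. assert (hz0 := Rabs_pos z).
  apply (ex_series_le (V := R_CompleteNormedModule) _
    (fun n => (zeta 2 + 1) * (z ^ 2) ^ n)).
  (* The summand 1 accounts for zeta(0) = -1/2. *)
  - intros n. change norm with Rabs. unfold zeta_term.
    assert (hp' : 1 <= INR p) by (apply (le_INR 1); lia).
    assert (hn := pos_INR n).
    assert (h2 := zeta_le_zeta_2 2 ltac:(lia)).
    assert (hzeta : Rabs (zeta (2 * n)) <= zeta 2 + 1).
    { destruct n as [| n].
      - simpl zeta at 1. rewrite Rabs_Ropp, Rabs_pos_eq; lra.
      - assert (h := zeta_le_zeta_2 (2 * S n) ltac:(lia)).
        rewrite Rabs_pos_eq; lra. }
    rewrite Rabs_div by lra. rewrite Rabs_mult, pow_mult.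
    assert (hq : 0 <= (z ^ 2) ^ n) by (apply pow_le; nra).
    rewrite (Rabs_pos_eq ((z ^ 2) ^ n)) by exact hq.
    rewrite (Rabs_pos_eq (2 * INR n + INR p)) by lra.
    apply Rcomplements.Rle_div_l; [lra |].
    assert (h3 := Rabs_pos (zeta (2 * n))).
    assert (h4 : Rabs (zeta (2 * n)) * (z ^ 2) ^ n <= (zeta 2 + 1) * (z ^ 2) ^ n)
      by (now apply Rmult_le_compat_r).
    assert (h5 : 0 <= (zeta 2 + 1) * (z ^ 2) ^ n) by (apply Rmult_le_pos; lra).
    nra.
  - apply (ex_series_scal (zeta 2 + 1) (fun n => (z ^ 2) ^ n)).
    apply ex_series_geom. rewrite <- RPow_abs. nra.
Qed.

(** As pi t cot(pi t) = -2 sum_n zeta(2n) t^(2n), this is -2 times the tail of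
    the expansion beyond rank N. *)
Definition cot_remainder (N : nat) (t : R) : R :=
  PI * t * cos (PI * t) / sin (PI * t)
  + 2 * sum_f_R0 (fun n => zeta (2 * n) * t ^ (2 * n)) N.

(** With x = (t / k)^2, the term of the partial fraction series is
    -2 x / (1 - x); adding 2 zeta(2n) t^(2n) adds 2 x^n to each term, and
    -x^n / (1 - x) + x^n = -x^(n+1) / (1 - x). *)
Lemma cot_remainder_series (N : nat) (t : R) :
  0 < t < 1 ->
  is_series (fun k => -2 * (((t / INR (S k)) ^ 2) ^ S N / (1 - (t / INR (S k)) ^ 2)))
    (cot_remainder N t).
Proof.
  intros ht.
  assert (hx : forall k, 0 < 1 - (t / INR (S k)) ^ 2).
  { intros k. assert (hk := INR_S_ge_1 k).
    assert (h : 0 < t / INR (S k) < 1).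
    { split; [apply Rdiv_lt_0_compat; lra |].
      apply Rcomplements.Rlt_div_l; lra. }
    nra. }
  induction N as [| N IH].
  - unfold cot_remainder. simpl sum_f_R0.
    replace (PI * t * cos (PI * t) / sin (PI * t) + 2 * (- (1 / 2) * 1))
      with (PI * t * cos (PI * t) / sin (PI * t) - 1) by lra.
    apply (is_series_eq (fun k => 2 * t ^ 2 / (t ^ 2 - INR (S k) ^ 2))).
    + intros k. assert (hk := INR_S_ge_1 k). specialize (hx k).
      set (m := INR (S k)) in *.
      assert (h : t ^ 2 - m ^ 2 < 0) by nra.
      field. split; [lra |]. split; nra.
    + now apply cot_partial_fractions.
  - replace (cot_remainder (S N) t)
      with (cot_remainder N t + 2 * t ^ (2 * S N) * zeta (2 * S N))
      by (unfold cot_remainder; rewrite (tech5 _ N); ring).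
    apply (is_series_eq (fun k =>
      (-2 * (((t / INR (S k)) ^ 2) ^ S N / (1 - (t / INR (S k)) ^ 2)))
      + 2 * t ^ (2 * S N) * (1 / INR (S k) ^ (2 * S N)))).
    + intros k. assert (hk := INR_S_ge_1 k). specialize (hx k).
      replace (2 * t ^ (2 * S N) * (1 / INR (S k) ^ (2 * S N)))
        with (2 * ((t / INR (S k)) ^ 2) ^ S N).
      * rewrite <- (tech_pow_Rmult ((t / INR (S k)) ^ 2) (S N)).
        set (x := (t / INR (S k)) ^ 2) in *. field. lra.
      * rewrite <- pow_mult. unfold Rdiv.
        rewrite Rpow_mult_distr, pow_inv. field. apply pow_nonzero. lra.
    + apply (is_series_plus (V := R_NormedModule)); [exact IH |].
      apply (is_series_scal (2 * t ^ (2 * S N))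
               (fun k => 1 / INR (S k) ^ (2 * S N))).
      apply is_series_zeta. lia.
Qed.

(** The bound is uniform in t and tends to 0 with N, which is what allows the
    expansion to be integrated term by term. *)
Lemma cot_remainder_bound (N : nat) (t z : R) :
  0 < t <= z -> z < 1 ->
  Rabs (cot_remainder N t) <= 2 / (1 - z ^ 2) * zeta 2 * (z ^ 2) ^ S N.
Proof.
  intros ht hz.
  assert (hser := cot_remainder_series N t ltac:(lra)).
  assert (h1z : 0 < 1 - z ^ 2) by nra.
  set (C := 2 / (1 - z ^ 2) * (z ^ 2) ^ S N).
  assert (hC : is_series (fun k => C * (1 / INR (S k) ^ 2)) (C * zeta 2)).
  { apply (is_series_scal C (fun k => 1 / INR (S k) ^ 2)).
    apply is_series_zeta. lia. }
  assert (hle : forall k,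
    0 <= Rabs (-2 * (((t / INR (S k)) ^ 2) ^ S N / (1 - (t / INR (S k)) ^ 2)))
      <= C * (1 / INR (S k) ^ 2)).
  { intros k. split; [apply Rabs_pos |]. assert (hk := INR_S_ge_1 k).
    set (m := INR (S k)) in *. set (u := 1 / m ^ 2).
    assert (hu : 0 < u <= 1).
    { unfold u. split; [apply Rdiv_lt_0_compat; nra |].
      apply Rcomplements.Rle_div_l; nra. }
    replace ((t / m) ^ 2) with (t ^ 2 * u) by (unfold u; field; lra).
    assert (h1 : 0 <= t ^ 2 * u <= z ^ 2) by nra.
    assert (h2 : (t ^ 2 * u) ^ S N <= (z ^ 2) ^ S N * u).
    { rewrite Rpow_mult_distr. apply Rmult_le_compat.
      - apply pow_le; nra.
      - apply pow_le; lra.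
      - apply pow_incr; nra.
      - rewrite <- tech_pow_Rmult. rewrite <- (Rmult_1_r u) at 3.
        apply Rmult_le_compat_l; [lra |]. rewrite <- (pow1 N). apply pow_incr. lra. }
    assert (h3 : 0 <= (t ^ 2 * u) ^ S N) by (apply pow_le; lra).
    rewrite Rabs_mult, Rabs_left by lra.
    rewrite Rabs_pos_eq.
    2:{ apply Rcomplements.Rdiv_le_0_compat; lra. }
    unfold C. replace (2 / (1 - z ^ 2) * (z ^ 2) ^ S N * u)
      with (2 * ((z ^ 2) ^ S N * u * / (1 - z ^ 2))) by (field; lra).
    replace (- -2) with 2 by ring. apply Rmult_le_compat_l; [lra |].
    unfold Rdiv. apply Rmult_le_compat; auto.
    - apply Rlt_le, Rinv_0_lt_compat; lra.
    - apply Rinv_le_contravar; lra. }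
  assert (hexC : ex_series (fun k => C * (1 / INR (S k) ^ 2)))
    by (eexists; exact hC).
  rewrite <- (is_series_unique _ _ hser).
  replace (2 / (1 - z ^ 2) * zeta 2 * (z ^ 2) ^ S N) with (C * zeta 2)
    by (unfold C; ring).
  rewrite <- (is_series_unique _ _ hC).
  apply Rle_trans with (2 := Series_le _ _ hle hexC).
  apply Series_Rabs.
  apply (ex_series_le (V := R_CompleteNormedModule) _
           (fun k => C * (1 / INR (S k) ^ 2))); [| exact hexC].
  intros k. change norm with Rabs. rewrite Rabs_Rabsolu. apply hle.
Qed.

(** * The two expansions have the same integral in the limit *)

Lemma zeta_sine_integral_vanishes (q : nat) (z : R) :
  0 < z < 1 ->
  is_lim_seq (fun n => RInt (fun x =>
      x ^ q * (-2 * sum_f_R0 (fun j => zeta (2 * j) * x ^ (2 * j)) n)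
      - sum_f_R0 (fun k => 2 * PI * (x ^ S q * sin (2 * PI * INR (S k) * x))) n) 0 z) 0.
Proof.
  intros hz. assert (hpi := PI2_3_2). assert (hpi4 := PI_4).
  assert (hs : forall x, 0 < x <= z -> 0 < sin (PI * x)).
  { intros x hx. apply sin_gt_0; nra. }
  assert (hpow : forall x, 0 < x <= 1 -> 0 < x ^ q <= 1).
  { intros x hx. split; [apply pow_lt; lra |].
    rewrite <- (pow1 q). apply pow_incr. lra. }
  set (dh := fun x => (INR (S q) * x ^ q * sin (PI * x)
                       - x ^ S q * (PI * cos (PI * x))) * PI / sin (PI * x) ^ 2).
  apply (RInt_oscillating_vanishes _ (fun x => PI * x ^ S q / sin (PI * x)) dh
    (fun n => 2 * PI * (INR n + 3 / 2))
    (fun n => 2 / (1 - z ^ 2) * zeta 2 * (z ^ 2) ^ S n) z (PI / 2) (z / 4) 2).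
  (* The phase pi / 2 turns the sine into the cosine of the kernel; x <= z / 4
     ensures pi x <= 1, hence sin(pi x) >= pi x / 2. *)
  - lra.
  - intros n x.
    apply (continuous_minus
      (fun x => x ^ q * (-2 * sum_f_R0 (fun j => zeta (2 * j) * x ^ (2 * j)) n))
      (fun x => sum_f_R0 (fun k => 2 * PI * (x ^ S q * sin (2 * PI * INR (S k) * x))) n)).
    + apply (continuous_mult (fun x => x ^ q)
        (fun x => -2 * sum_f_R0 (fun j => zeta (2 * j) * x ^ (2 * j)) n)).
      * apply (ex_derive_continuous (fun x => x ^ q)). now auto_derive.
      * apply (continuous_mult (fun _ => -2)
          (fun x => sum_f_R0 (fun j => zeta (2 * j) * x ^ (2 * j)) n)).
        -- apply continuous_const.
        -- apply (continuous_sum_f_R0 (fun j x => zeta (2 * j) * x ^ (2 * j))).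
           intros j. apply (ex_derive_continuous (fun x => zeta (2 * j) * x ^ (2 * j))).
           auto_derive. exact I.
    + apply (continuous_sum_f_R0
        (fun k x => 2 * PI * (x ^ S q * sin (2 * PI * INR (S k) * x)))).
      intros k. apply (ex_derive_continuous
        (fun x => 2 * PI * (x ^ S q * sin (2 * PI * INR (S k) * x)))).
      auto_derive. exact I.
  - intros x hx. specialize (hs x hx). unfold dh. auto_derive.
    + lra.
    + change (match q with O => 1 | S _ => INR q + 1 end) with (INR (S q)).
      rewrite <- tech_pow_Rmult. field. lra.
  - intros x hx. specialize (hs x hx). apply (ex_derive_continuous dh).
    unfold dh. auto_derive. nra.
  - intros x hx. specialize (hs x ltac:(lra)).
    assert (h1 := sin_ge_half (PI * x) ltac:(nra)).
    specialize (hpow x ltac:(lra)).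
    assert (h2 : 0 < PI * x ^ S q) by (simpl; apply Rmult_lt_0_compat; nra).
    rewrite Rabs_div, (Rabs_pos_eq (sin _)), Rabs_pos_eq by lra.
    apply Rcomplements.Rle_div_l; [lra |].
    apply Rle_trans with (PI * x); [| lra].
    apply Rmult_le_compat_l; [lra |]. simpl. nra.
  - intros n x hx. specialize (hs x ltac:(lra)).
    specialize (hpow x ltac:(lra)).
    assert (hb := cot_remainder_bound n x z ltac:(lra) ltac:(lra)).
    rewrite sin_plus, cos_PI2, sin_PI2.
    assert (hD := dirichlet_kernel_sin n (2 * PI * x)).
    replace (2 * PI * x / 2) with (PI * x) in hD by field.
    rewrite (sum_eq (fun k => 2 * PI * (x ^ S q * sin (2 * PI * INR (S k) * x)))
      (fun k => sin (INR (S k) * (2 * PI * x)) * (2 * PI * x ^ S q))).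
    2:{ intros k _. replace (INR (S k) * (2 * PI * x)) with (2 * PI * INR (S k) * x)
          by ring. ring. }
    rewrite <- scal_sum.
    replace (2 * PI * (INR n + 3 / 2) * x) with ((INR n + 3 / 2) * (2 * PI * x)) by ring.
    unfold cot_remainder in hb. rewrite <- tech_pow_Rmult.
    set (S1 := sum_f_R0 (fun j => zeta (2 * j) * x ^ (2 * j)) n) in *.
    set (S2 := sum_f_R0 (fun k => sin (INR (S k) * (2 * PI * x))) n) in *.
    set (cn := cos ((INR n + 3 / 2) * (2 * PI * x))) in *.
    assert (hS2 : S2 = (cos (PI * x) - cn) / (2 * sin (PI * x))).
    { rewrite <- hD. field. lra. }
    rewrite hS2.
    match goal with |- Rabs ?a <= _ =>
      replace a with
        (- (x ^ q * (PI * x * cos (PI * x) / sin (PI * x) + 2 * S1)))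
        by (field; lra) end.
    rewrite Rabs_Ropp, Rabs_mult, (Rabs_pos_eq (x ^ q)) by lra.
    apply Rle_trans with (2 := hb).
    rewrite <- Rmult_1_l. apply Rmult_le_compat_r; [apply Rabs_pos | lra].
  - apply is_lim_seq_frequency. lra.
  - replace (Finite 0) with (Rbar_mult (2 / (1 - z ^ 2) * zeta 2) 0)
      by (simpl; f_equal; ring).
    apply is_lim_seq_scal_l.
    apply -> (is_lim_seq_incr_1 (fun n => (z ^ 2) ^ n)).
    apply is_lim_seq_geom. rewrite Rabs_pos_eq; nra.
Qed.

(** * Integrals of powers times sines *)

Definition clausen_trig (n : nat) (x : R) : R := if Nat.even n then sin x else cos x.

(** The sequence -cos, sin, cos, -sin, -cos, ...: integrating by parts
    repeatedly replaces each function by minus the next one, starting from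
    the primitive -cos of sin.  The sign is that of the coefficient
    of Cl_{j+1}. *)
Definition sin_primitive (j : nat) (x : R) : R :=
  (-1) ^ ((j + 3) / 2) * clausen_trig (j + 1) x.

Lemma sin_primitive_even (r : nat) (x : R) :
  sin_primitive (2 * r) x = (-1) ^ S r * cos x.
Proof.
  unfold sin_primitive, clausen_trig.
  replace (2 * r + 3)%nat with (1 + S r * 2)%nat by lia.
  rewrite Nat.div_add by lia.
  replace (2 * r + 1)%nat with (1 + r * 2)%nat by lia.
  replace (Nat.even (1 + r * 2)) with false; [reflexivity |].
  symmetry. rewrite Nat.even_add, Nat.even_mul, Bool.orb_true_r. reflexivity.
Qed.

Lemma sin_primitive_odd (r : nat) (x : R) :
  sin_primitive (2 * r + 1) x = (-1) ^ r * sin x.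
Proof.
  unfold sin_primitive, clausen_trig.
  replace (2 * r + 1 + 3)%nat with (0 + S (S r) * 2)%nat by lia.
  rewrite Nat.div_add by lia.
  replace (2 * r + 1 + 1)%nat with (S r * 2)%nat by lia.
  replace (Nat.even (S r * 2)) with true.
  - change (0 / 2 + S (S r))%nat with (S (S r)). simpl. ring.
  - rewrite Nat.even_mul, Bool.orb_true_r. reflexivity.
Qed.

Lemma is_derive_sin_primitive_0 (x : R) : is_derive (sin_primitive 0) x (sin x).
Proof.
  apply (is_derive_ext (fun y => (-1) ^ 1 * cos y)).
  - intros y. symmetry. apply (sin_primitive_even 0).
  - auto_derive; [exact I | ring].
Qed.

Lemma is_derive_sin_primitive_S (j : nat) (x : R) :
  is_derive (sin_primitive (S j)) x (- sin_primitive j x).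
Proof.
  destruct (Nat.Even_or_Odd j) as [[r ->] | [r ->]].
  - rewrite sin_primitive_even. replace (S (2 * r)) with (2 * r + 1)%nat by lia.
    apply (is_derive_ext (fun y => (-1) ^ r * sin y)).
    + intros y. symmetry. apply sin_primitive_odd.
    + auto_derive; [exact I | simpl; ring].
  - rewrite sin_primitive_odd. replace (S (2 * r + 1)) with (2 * S r)%nat by lia.
    apply (is_derive_ext (fun y => (-1) ^ S (S r) * cos y)).
    + intros y. symmetry. apply sin_primitive_even.
    + auto_derive; [exact I | simpl; ring].
Qed.

Definition pow_sin_primitive (p : nat) (w : R) (m : nat) (t : R) : R :=
  sum_f_R0 (fun j => INR (fact p) / INR (fact (p - j)) * t ^ (p - j)
                     * sin_primitive j (w * t) / w ^ S j) m.

(** The sum telescopes: differentiating the power in the term of index j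
    cancels against differentiating the trigonometric factor in the term of
    index j + 1.  For m = p the remaining power has derivative 0. *)
Lemma is_derive_pow_sin_primitive (p : nat) (w : R) (m : nat) (t : R) :
  w <> 0 -> (m <= p)%nat ->
  is_derive (pow_sin_primitive p w m) t
    (t ^ p * sin (w * t)
     + INR (fact p) / INR (fact (p - m)) * (INR (p - m) * t ^ pred (p - m))
       * sin_primitive m (w * t) / w ^ S m).
Proof.
  intros hw. unfold pow_sin_primitive.
  assert (hfact : forall r, INR (fact r) <> 0) by (intros; apply INR_fact_neq_0).
  induction m as [| m IH]; intros hm.
  - cbn [sum_f_R0]. rewrite Nat.sub_0_r. rewrite pow_1.
    assert (hd := is_derive_sin_primitive_0 (w * t)).
    auto_derive.
    + now exists (sin (w * t)).
    + replace (Derive (fun x => sin_primitive 0 x) (w * t)) with (sin (w * t))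
        by (symmetry; apply is_derive_unique, hd).
      field. auto.
  - cbn [sum_f_R0].
    assert (hd := is_derive_sin_primitive_S m (w * t)).
    evar_last.
    { apply (is_derive_plus (V := R_NormedModule)); [apply IH; lia |].
      instantiate (1 := INR (fact p) / INR (fact (p - S m)) *
        (INR (p - S m) * t ^ pred (p - S m) * sin_primitive (S m) (w * t)
         - t ^ (p - S m) * w * sin_primitive m (w * t)) / w ^ S (S m)).
      auto_derive.
      - now exists (- sin_primitive m (w * t)).
      - replace (Derive (fun x => sin_primitive (S m) x) (w * t))
          with (- sin_primitive m (w * t))
          by (symmetry; apply is_derive_unique, hd).
        rewrite <- (tech_pow_Rmult w (S m)), <- (tech_pow_Rmult w m). field. auto using pow_nonzero. }
    change plus with Rplus.
    destruct (p - m)%nat as [| r] eqn:hr; [lia |].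
    replace (p - S m)%nat with r by lia.
    rewrite fact_simpl, mult_INR. cbn [pred].
    assert (hS : INR (S r) <> 0) by (now apply not_0_INR).
    rewrite <- !tech_pow_Rmult. field.
    repeat split; auto. now apply pow_nonzero.
Qed.

Lemma is_RInt_pow_sin (p : nat) (w z : R) :
  w <> 0 ->
  is_RInt (fun t => t ^ p * sin (w * t)) 0 z
    (pow_sin_primitive p w p z - pow_sin_primitive p w p 0).
Proof.
  intros hw. apply is_RInt_antiderivative.
  - intros t. evar_last; [now apply is_derive_pow_sin_primitive |].
    rewrite Nat.sub_diag. simpl INR. unfold Rdiv. ring.
  - intros t. apply (ex_derive_continuous (fun t => t ^ p * sin (w * t))).
    now auto_derive.
Qed.

(** Only the term without a power of t is nonzero at 0, and its trigonometric
    factor is a sine when p is odd. *)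
Lemma pow_sin_primitive_0 (p : nat) (w : R) :
  pow_sin_primitive p w p 0
  = if Nat.even p then - (INR (fact p) * (-1) ^ (p / 2) / w ^ S p) else 0.
Proof.
  assert (hlow : forall m, (m < p)%nat -> pow_sin_primitive p w m 0 = 0).
  { intros m. unfold pow_sin_primitive. induction m as [| m IH]; intros hm.
    - cbn [sum_f_R0]. rewrite pow_i by lia. unfold Rdiv. ring.
    - cbn [sum_f_R0]. rewrite IH, pow_i by lia. unfold Rdiv. ring. }
  assert (htop : pow_sin_primitive p w p 0
                 = INR (fact p) * sin_primitive p 0 / w ^ S p).
  { destruct p as [| p].
    - unfold pow_sin_primitive. cbn [sum_f_R0]. rewrite Rmult_0_r. simpl.
      unfold Rdiv. rewrite Rinv_1. ring.
    - unfold pow_sin_primitive in *. rewrite tech5, hlow by lia.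
      rewrite Nat.sub_diag, Rmult_0_r. simpl fact at 2. simpl INR at 2.
      rewrite pow_O. unfold Rdiv. rewrite Rinv_1. ring. }
  rewrite htop. destruct (Nat.Even_or_Odd p) as [[r ->] | [r ->]].
  - rewrite sin_primitive_even, cos_0.
    replace (Nat.even (2 * r)) with true
      by (symmetry; now rewrite Nat.even_mul).
    rewrite (Nat.mul_comm 2 r), Nat.div_mul by lia. simpl pow at 1. unfold Rdiv. ring.
  - rewrite sin_primitive_odd, sin_0.
    replace (Nat.even (2 * r + 1)) with false
      by (symmetry; now rewrite Nat.even_add, Nat.even_mul).
    unfold Rdiv. ring.
Qed.

(** * The Clausen expansion *)

Lemma is_series_sum_of_series (f : nat -> nat -> R) (l : nat -> R) (m : nat) :
  (forall j, (j <= m)%nat -> is_series (f j) (l j)) ->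
  is_series (fun i => sum_f_R0 (fun j => f j i) m) (sum_f_R0 l m).
Proof.
  intros hf. induction m as [| m IH]; [apply hf; lia |].
  apply (is_series_plus (V := R_NormedModule)
           (fun i => sum_f_R0 (fun j => f j i) m) (f (S m))); auto.
Qed.

Definition clausen_coeff (p : nat) (z : R) (k : nat) : R :=
  INR (fact p) * (-1) ^ ((k + 3) / 2) / (INR (fact (p - k)) * (2 * PI * z) ^ k).

Definition zeta_coeff (p : nat) (z : R) : R :=
  if Nat.even p then INR (fact p) * (-1) ^ (p / 2) / (2 * PI * z) ^ p else 0.

Definition clausen_term (n : nat) (theta : R) (i : nat) : R :=
  clausen_trig n (INR (S i) * theta) / INR (S i) ^ n.

Lemma is_RInt_clausen_terms (p : nat) (z : R) (i : nat) :
  0 < z ->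
  is_RInt (fun t => 2 * PI * (t ^ p * sin (2 * PI * INR (S i) * t))) 0 z
    (z ^ p * (sum_f_R0 (fun k => clausen_coeff p z k
                                 * clausen_term (k + 1) (2 * PI * z) i) p
              + zeta_coeff p z * (1 / INR (S i) ^ (p + 1)))).
Proof.
  intros hz. assert (hpi := PI_RGT_0). assert (hi := INR_S_ge_1 i).
  set (m := INR (S i)) in *. set (w := 2 * PI * m).
  assert (hw : 0 < w) by (unfold w; nra).
  match goal with |- is_RInt _ _ _ ?v => replace v with
    (2 * PI * (pow_sin_primitive p w p z - pow_sin_primitive p w p 0)) end.
  { apply (is_RInt_scal (V := R_NormedModule) (fun t => t ^ p * sin (w * t))).
    apply is_RInt_pow_sin. lra. }
  rewrite Rmult_minus_distr_l, Rmult_plus_distr_l. unfold Rminus. f_equal.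
  - unfold pow_sin_primitive. rewrite !scal_sum. apply sum_eq. intros k hk.
    unfold clausen_coeff, clausen_term, sin_primitive. fold m.
    replace (m * (2 * PI * z)) with (w * z) by (unfold w; ring).
    assert (hzp : z ^ p = z ^ (p - k) * z ^ k)
      by (rewrite <- pow_add; f_equal; lia).
    rewrite hzp, Nat.add_1_r, <- !tech_pow_Rmult. unfold w.
    rewrite !Rpow_mult_distr.
    assert (hf := INR_fact_neq_0 (p - k)).
    field. repeat split; auto; try (apply pow_nonzero); lra.
  - rewrite pow_sin_primitive_0. unfold zeta_coeff.
    destruct (Nat.even p); [| ring].
    rewrite Nat.add_1_r, <- !tech_pow_Rmult. unfold w. rewrite !Rpow_mult_distr.
    field. repeat split; try (apply pow_nonzero); lra.
Qed.

Lemma is_RInt_zeta_polynomial (q : nat) (z : R) (n : nat) :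
  is_RInt (fun x => x ^ q * (-2 * sum_f_R0 (fun j => zeta (2 * j) * x ^ (2 * j)) n)) 0 z
    (z ^ S q * (-2 * sum_f_R0 (zeta_term (S q) z) n)).
Proof.
  replace (z ^ S q * (-2 * sum_f_R0 (zeta_term (S q) z) n))
    with (sum_f_R0 (fun j => zeta_term (S q) z j * (z ^ S q * -2)) n)
    by (rewrite <- scal_sum; ring).
  apply (is_RInt_ext (V := R_NormedModule)
    (fun x => sum_f_R0 (fun j => -2 * zeta (2 * j) * x ^ (2 * j + q)) n)).
  { intros x _.
    rewrite (sum_eq _ (fun j => zeta (2 * j) * x ^ (2 * j) * (x ^ q * -2))).
    - rewrite <- scal_sum.
      match goal with |- ?a = ?b => change (@eq R a b) end. ring.
    - intros j _. rewrite pow_add. ring. }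
  apply (is_RInt_sum_f_R0 (fun j x => -2 * zeta (2 * j) * x ^ (2 * j + q))).
  intros j. set (r := (2 * j + q)%nat).
  assert (hr : INR (S r) <> 0) by (now apply not_0_INR).
  replace (zeta_term (S q) z j * (z ^ S q * -2)) with
    (-2 * zeta (2 * j) * (z ^ S r / INR (S r))
     - -2 * zeta (2 * j) * (0 ^ S r / INR (S r))).
  - apply (is_RInt_antiderivative
             (fun x => -2 * zeta (2 * j) * (x ^ S r / INR (S r)))).
    + intros x. auto_derive; [exact I |].
      change (match r with O => 1 | S _ => INR r + 1 end) with (INR (S r)).
      change (j + (j + 0))%nat with (2 * j)%nat. field. exact hr.
    + intros x. apply (ex_derive_continuous (fun x => -2 * zeta (2 * j) * x ^ r)).
      auto_derive. exact I.
  - rewrite pow_i by lia. unfold zeta_term.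
    replace (2 * INR j + INR (S q)) with (INR (S r)).
    + replace (S r) with (2 * j + S q)%nat by (unfold r; lia).
      rewrite pow_add. field. now replace (2 * j + S q)%nat with (S r) by (unfold r; lia).
    + unfold r. rewrite !S_INR, plus_INR, mult_INR. simpl. ring.
Qed.

(** The terms of all the Clausen series are summed together, because only this
    combination is known to converge before Cl_1 is separated from it. *)
Lemma is_series_clausen_terms (p : nat) (z : R) :
  (1 <= p)%nat -> 0 < z < 1 ->
  is_series (fun i => sum_f_R0 (fun k => clausen_coeff p z k
                         * clausen_term (k + 1) (2 * PI * z) i) p
                      + zeta_coeff p z * (1 / INR (S i) ^ (p + 1)))
    (-2 * Series (zeta_term p z)).
Proof.
  intros hp hz. apply is_series_sum_f_R0.
  assert (hL : is_lim_seq (sum_f_R0 (zeta_term p z)) (Series (zeta_term p z))).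
  { apply is_series_sum_f_R0, Series_correct, ex_series_zeta_term; [exact hp |].
    rewrite Rabs_pos_eq; lra. }
  destruct p as [| q]; [lia |].
  assert (h := zeta_sine_integral_vanishes q z hz).
  assert (hzq : z ^ S q <> 0) by (apply pow_nonzero; lra).
  set (T := fun i => sum_f_R0 (fun k => clausen_coeff (S q) z k
                         * clausen_term (k + 1) (2 * PI * z) i) (S q)
                     + zeta_coeff (S q) z * (1 / INR (S i) ^ (S q + 1))) in *.
  apply (is_lim_seq_ext (fun n =>
    -2 * sum_f_R0 (zeta_term (S q) z) n
    - / z ^ S q * RInt (fun x =>
      x ^ q * (-2 * sum_f_R0 (fun j => zeta (2 * j) * x ^ (2 * j)) n)
      - sum_f_R0 (fun k => 2 * PI * (x ^ S q * sin (2 * PI * INR (S k) * x))) n) 0 z)).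
  - intros n.
    replace (RInt _ 0 z) with
      (z ^ S q * (-2 * sum_f_R0 (zeta_term (S q) z) n)
       - sum_f_R0 (fun i => z ^ S q * T i) n).
    + rewrite (sum_eq (fun i => z ^ S q * T i) (fun i => T i * z ^ S q))
        by (intros; ring).
      rewrite <- scal_sum. field. exact hzq.
    + symmetry. apply is_RInt_unique.
      apply (is_RInt_minus (V := R_NormedModule)
       (fun x => x ^ q * (-2 * sum_f_R0 (fun j => zeta (2 * j) * x ^ (2 * j)) n))
       (fun x => sum_f_R0 (fun k => 2 * PI * (x ^ S q * sin (2 * PI * INR (S k) * x))) n)).
      * apply is_RInt_zeta_polynomial.
      * apply (is_RInt_sum_f_R0
          (fun k x => 2 * PI * (x ^ S q * sin (2 * PI * INR (S k) * x)))).
        intros i. apply is_RInt_clausen_terms. lra.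
  - replace (Finite (-2 * Series (zeta_term (S q) z))) with
      (Finite (-2 * Series (zeta_term (S q) z) - / z ^ S q * 0)) by (f_equal; ring).
    apply is_lim_seq_minus'.
    + apply (is_lim_seq_scal_l _ (-2) (Finite (Series (zeta_term (S q) z)))). exact hL.
    + apply (is_lim_seq_scal_l _ (/ z ^ S q) (Finite 0)). exact h.
Qed.

Lemma is_series_Cl (n : nat) (theta : R) :
  (2 <= n)%nat -> is_series (clausen_term n theta) (Cl n theta).
Proof.
  intros hn. apply (Series_correct (clausen_term n theta)).
  apply (ex_series_le (V := R_CompleteNormedModule) _ (fun i => 1 / INR (S i) ^ n)).
  - intros i. change norm with Rabs. unfold clausen_term, clausen_trig.
    assert (hi := INR_S_ge_1 i).
    assert (hpos : 0 < INR (S i) ^ n) by (apply pow_lt; lra).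
    rewrite Rabs_div, (Rabs_pos_eq (_ ^ n)) by lra.
    apply Rmult_le_compat_r; [apply Rlt_le, Rinv_0_lt_compat, hpos |].
    destruct (Nat.even n); apply Rabs_le; [apply SIN_bound | apply COS_bound].
  - now apply ex_series_inv_pow.
Qed.

(** Subtracting the absolutely convergent series leaves the series of Cl_1,
    whose coefficient is -1. *)
Lemma clausen_expansion_pos (p : nat) (z : R) :
  (1 <= p)%nat -> 0 < z < 1 ->
  -2 * Series (zeta_term p z) =
    sum_f_R0 (fun k => clausen_coeff p z k * Cl (k + 1) (2 * PI * z)) p
    + zeta_coeff p z * zeta (p + 1).
Proof.
  intros hp hz. assert (hall := is_series_clausen_terms p z hp hz).
  set (theta := 2 * PI * z) in *.
  assert (hzeta : is_series (fun i => zeta_coeff p z * (1 / INR (S i) ^ (p + 1)))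
                    (zeta_coeff p z * zeta (p + 1))).
  { apply (is_series_scal (zeta_coeff p z) (fun i => 1 / INR (S i) ^ (p + 1))).
    apply is_series_zeta. lia. }
  assert (hhigh : is_series
    (fun i => sum_f_R0 (fun k => clausen_coeff p z (S k)
                                 * clausen_term (S k + 1) theta i) (pred p))
    (sum_f_R0 (fun k => clausen_coeff p z (S k) * Cl (S k + 1) theta) (pred p))).
  { apply (is_series_sum_of_series
      (fun k i => clausen_coeff p z (S k) * clausen_term (S k + 1) theta i)).
    intros k _. apply (is_series_scal (V := R_NormedModule) (clausen_coeff p z (S k))).
    apply is_series_Cl. lia. }
  assert (hc0 : clausen_coeff p z 0 = -1).
  { unfold clausen_coeff. rewrite Nat.sub_0_r. simpl. field. apply INR_fact_neq_0. }
  assert (hlow : is_series (clausen_term 1 theta)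
    (sum_f_R0 (fun k => clausen_coeff p z (S k) * Cl (S k + 1) theta) (pred p)
     + zeta_coeff p z * zeta (p + 1) - -2 * Series (zeta_term p z))).
  { apply (is_series_eq (fun i =>
      (sum_f_R0 (fun k => clausen_coeff p z (S k)
                          * clausen_term (S k + 1) theta i) (pred p)
       + zeta_coeff p z * (1 / INR (S i) ^ (p + 1)))
      - (sum_f_R0 (fun k => clausen_coeff p z k * clausen_term (k + 1) theta i) p
         + zeta_coeff p z * (1 / INR (S i) ^ (p + 1))))).
    - intros i.
      rewrite (decomp_sum (fun k => clausen_coeff p z k * clausen_term (k + 1) theta i))
        by lia.
      rewrite hc0. simpl (0 + 1)%nat. ring.
    - apply (is_series_minus (V := R_NormedModule)); [| exact hall].
      now apply (is_series_plus (V := R_NormedModule)). }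
  apply is_series_unique in hlow. change (Series (clausen_term 1 theta)) with (Cl 1 theta) in hlow.
  rewrite (decomp_sum (fun k => clausen_coeff p z k * Cl (k + 1) theta)) by lia.
  rewrite hc0. simpl (0 + 1)%nat. rewrite hlow. ring.
Qed.

(** * Parity in z *)

Lemma zeta_term_opp (p : nat) (z : R) (n : nat) : zeta_term p (- z) n = zeta_term p z n.
Proof.
  unfold zeta_term. rewrite !pow_mult. now replace ((- z) ^ 2) with (z ^ 2) by ring.
Qed.

Lemma Cl_opp (k : nat) (theta : R) : Cl (k + 1) (- theta) = (-1) ^ k * Cl (k + 1) theta.
Proof.
  unfold Cl. rewrite <- Series_scal_l. apply Series_ext. intros i.
  rewrite Ropp_mult_distr_r_reverse, sin_neg, cos_neg.
  destruct (Nat.Even_or_Odd k) as [[r ->] | [r ->]].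
  - replace (Nat.even (2 * r + 1)) with false
      by (symmetry; now rewrite Nat.even_add, Nat.even_mul).
    rewrite pow_1_even. ring.
  - replace (Nat.even (2 * r + 1 + 1)) with true
      by (symmetry; now rewrite !Nat.even_add, Nat.even_mul).
    replace (2 * r + 1)%nat with (S (2 * r)) at 2 by lia.
    rewrite pow_1_odd. unfold Rdiv. ring.
Qed.

Lemma clausen_coeff_opp (p k : nat) (z : R) :
  z <> 0 -> clausen_coeff p (- z) k = (-1) ^ k * clausen_coeff p z k.
Proof.
  intros hz. unfold clausen_coeff.
  assert (hpi := PI_RGT_0).
  assert (hf := INR_fact_neq_0 (p - k)).
  assert (hp1 : (-1) ^ k * (-1) ^ k = 1).
  { rewrite <- Rpow_mult_distr. replace (-1 * -1) with 1 by ring. apply pow1. }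
  assert (hs : (-1) ^ k <> 0) by (apply pow_nonzero; lra).
  assert (ht : (2 * PI * z) ^ k <> 0) by (apply pow_nonzero; nra).
  replace (2 * PI * - z) with (-1 * (2 * PI * z)) by ring.
  rewrite Rpow_mult_distr.
  apply (Rmult_eq_reg_r ((-1) ^ k)); [| exact hs].
  transitivity (((-1) ^ k * (-1) ^ k) * (INR (fact p) * (-1) ^ ((k + 3) / 2) /
     (INR (fact (p - k)) * (2 * PI * z) ^ k))).
  - rewrite hp1. field. auto.
  - ring.
Qed.

Lemma zeta_coeff_opp (p : nat) (z : R) : zeta_coeff p (- z) = zeta_coeff p z.
Proof.
  unfold zeta_coeff. destruct (Nat.even p) eqn:he; [| reflexivity].
  apply Nat.even_spec in he. destruct he as [r ->].
  rewrite !(pow_mult _ 2 r). now replace ((2 * PI * - z) ^ 2) with ((2 * PI * z) ^ 2) by ring.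
Qed.

Theorem mainTheorem2 (p : nat) (z : R) (hp : (1 <= p)%nat)
  (hz : 0 < Rabs z < 1) :
  ex_series (zeta_term p z) /\
  - 2 * Series (zeta_term p z) =
    sum_f_R0 (fun k : nat =>
      INR (fact p) * (-1) ^ ((k + 3) / 2)
        / (INR (fact (p - k)) * (2 * PI * z) ^ k)
        * Cl (k + 1) (2 * PI * z)) p
    + (if Nat.even p then
         INR (fact p) * (-1) ^ (p / 2) / (2 * PI * z) ^ p * zeta (p + 1)
       else 0).
Proof.
  split; [now apply ex_series_zeta_term |].
  assert (hmain : -2 * Series (zeta_term p z) =
    sum_f_R0 (fun k => clausen_coeff p z k * Cl (k + 1) (2 * PI * z)) p
    + zeta_coeff p z * zeta (p + 1)).
  { destruct (Rle_or_lt 0 z) as [h0 | h0].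
    - rewrite Rabs_pos_eq in hz by exact h0. now apply clausen_expansion_pos.
    - rewrite Rabs_left in hz by exact h0.
      rewrite <- (Series_ext _ _ (zeta_term_opp p z)).
      rewrite clausen_expansion_pos, zeta_coeff_opp by (auto; lra).
      f_equal. apply sum_eq. intros k _.
      replace (2 * PI * - z) with (- (2 * PI * z)) by ring.
      rewrite Cl_opp, clausen_coeff_opp by lra.
      replace ((-1) ^ k * clausen_coeff p z k * ((-1) ^ k * Cl (k + 1) (2 * PI * z)))
        with ((-1 * -1) ^ k * (clausen_coeff p z k * Cl (k + 1) (2 * PI * z)))
        by (rewrite Rpow_mult_distr; ring).
      replace (-1 * -1) with 1 by ring. rewrite pow1. ring. }
  rewrite hmain. unfold zeta_coeff, clausen_coeff.
  destruct (Nat.even p); [reflexivity | ring].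
Qed.
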